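(* Let $L_\psi>0$ and let $\phi:\mathbb{R}^N\to\mathbb{R}\cup\{+\infty\}$ be a proper, lower semicontinuous, $(1-1/L_\psi)$-weakly convex function with prox-bound $\lambda_\phi>1$. Let $\epsilon>0$ and let $g_b:\mathbb{R}^N\to\mathbb{R}^N$ be an $\epsilon$-type (b) approximation of $\mathrm{prox}_\phi$. Then $$\forall x,y\in\mathbb{R}^N,\quad \|g_b(x)-g_b(y)\|\le L_\psi\left(\|x-y\|+2\epsilon\right).$$
   Context: $\phi$ is $\rho$-weakly convex if $\phi+\frac{\rho}{2}\|\cdot\|^2$ is convex. The prox-bound $\lambda_\phi$ is the supremum of all $\lambda>0$ such that $\inf_{x}\{\phi(x)+\frac1{2\lambda}\|x-y\|^2\}>-\infty$ for some $y\in\mathbb{R}^N$. The proximal operator is $\mathrm{prox}_\phi(y)=\operatorname{argmin}_{x\in\mathbb{R}^N}\{\phi(x)+\frac12\|x-y\|^2\}$. $g_b$ is an $\epsilon$-type (b) approximation of $\mathrm{prox}_\phi$ if for all $y\in\mathbb{R}^N$ there exists $r(y)\in\mathbb{R}^N$ with $\|r(y)\|\le\epsilon$ and $g_b(y)=\mathrm{prox}_\phi(y+r(y))$. *)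

(* Defs.v *)
From mathcomp Require Import all_boot all_order all_algebra.
From mathcomp Require Import all_classical all_reals all_analysis.
Import Order.TTheory GRing.Theory Num.Theory.
Import numFieldNormedType.Exports.

Set Implicit Arguments.
Unset Strict Implicit.
Unset Printing Implicit Defensive.

Local Open Scope classical_set_scope.
Local Open Scope ring_scope.

Section ProximalOperator.
Context {R : realType} {N : nat}.
Implicit Types (phi : 'rV[R]_N -> \bar R) (x y z : 'rV[R]_N).

(* The library norm `|x| on 'rV[R]_N is the sup norm, hence this definition;
   both norms induce the canonical topology of 'rV[R]_N. *)
Definition enorm x : R := Num.sqrt (\sum_(i < N) x ord0 i ^+ 2).

(* Functions with values in R U {+oo} are functions into \bar R that never
   take the value -oo. *)
Definition proper_efun phi : Prop :=
  (forall x, (phi x != -oo)%E) /\ (exists x, phi x < +oo)%E.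

(* Meant for functions that never take the value -oo, so that the right-hand
   side is never +oo - oo; recall that 0 * +oo = 0. *)
Definition econvex phi : Prop :=
  forall x y (t : R), 0 <= t <= 1 ->
    (phi (t *: x + (1 - t) *: y)%R <= t%:E * phi x + (1 - t)%:E * phi y)%E.

Definition weakly_convex (rho : R) phi : Prop :=
  econvex (fun x => phi x + (rho / 2 * enorm x ^+ 2)%:E)%E.

(* The supremum is taken in \bar R: it is -oo when no lambda qualifies. *)
Definition prox_bound phi : \bar R :=
  ereal_sup [set lambda%:E | lambda in [set lambda : R | 0 < lambda /\
    exists y, (-oo < ereal_inf
      [set phi x + (1 / (2 * lambda) * enorm (x - y) ^+ 2)%:E | x in setT])%E]].

Definition argmin (f : 'rV[R]_N -> \bar R) : set 'rV[R]_N :=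
  [set x | forall z, (f x <= f z)%E].

Definition prox phi y : set 'rV[R]_N :=
  argmin (fun x => phi x + (1 / 2 * enorm (x - y) ^+ 2)%:E)%E.

(* As usual, g y = prox phi (y + r) means that the minimizer is unique and
   equal to g y. *)
Definition type_b_approx (eps : R) phi (g : 'rV[R]_N -> 'rV[R]_N) : Prop :=
  forall y, exists r : 'rV[R]_N,
    enorm r <= eps /\ prox phi (y + r) = [set g y].

End ProximalOperator.

(* Main.v *)
Require Import Defs.
From mathcomp Require Import all_boot all_order all_algebra.
From mathcomp Require Import all_classical all_reals all_analysis.
From mathcomp Require Import ring lra.
Import Order.TTheory GRing.Theory Num.Theory.
Import numFieldNormedType.Exports.

Local Open Scope classical_set_scope.
Local Open Scope ring_scope.

(** Put [rho = 1 - 1/L].  The objective [phi + |. - y|^2/2] whose minimizer is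
    the prox at [y] is the convex function [phi + rho/2 |.|^2] plus
    [1/(2L) |.|^2] plus an affine function, hence it is strongly convex of
    modulus [1/L] and grows at least like [|v - u|^2 / (2L)] away from its
    minimizer [u].  Adding these growth inequalities for the minimizers [u], [v]
    attached to two points [y], [z] cancels the values of [phi] and leaves
    [|u - v|^2 / L <= <u - v, y - z>] ([prox_cocoercive]).  By Young's inequality
    [prox phi] is then [L]-Lipschitz ([prox_lipschitz]).  Finally [g x] and [g y]
    are exact proximal points of perturbed inputs, whose distance exceeds
    [|x - y|] by at most [2 eps], by the triangle inequality. *)

Section Euclidean.
Context {R : realType} {N : nat}.
Implicit Types u v w x y : 'rV[R]_N.

Definition dot u v : R := \sum_(i < N) u ord0 i * v ord0 i.

Lemma dotC u v : dot u v = dot v u.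
Proof. by apply: eq_bigr => i _; rewrite mulrC. Qed.

Lemma dotDl u v w : dot (u + v) w = dot u w + dot v w.
Proof. by rewrite -big_split; apply: eq_bigr => i _; rewrite mxE mulrDl. Qed.

Lemma dotZl a u v : dot (a *: u) v = a * dot u v.
Proof. by rewrite mulr_sumr; apply: eq_bigr => i _; rewrite mxE mulrA. Qed.

Lemma dotNl u v : dot (- u) v = - dot u v.
Proof. by rewrite -scaleN1r dotZl mulN1r. Qed.

Lemma dotDr u v w : dot w (u + v) = dot w u + dot w v.
Proof. by rewrite dotC dotDl !(dotC w). Qed.

Lemma dotZr a u v : dot u (a *: v) = a * dot u v.
Proof. by rewrite dotC dotZl dotC. Qed.

Lemma dotNr u v : dot u (- v) = - dot u v.
Proof. by rewrite dotC dotNl dotC. Qed.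

Definition dotE := (dotDl, dotDr, dotNl, dotNr, dotZl, dotZr).

Lemma dot_ge0 u : 0 <= dot u u.
Proof. by apply: sumr_ge0 => i _; rewrite -expr2 sqr_ge0. Qed.

Lemma dot_eq0 u : dot u u = 0 -> u = 0.
Proof.
move=> /eqP; rewrite psumr_eq0 => [/allP u0|i _]; last by rewrite -expr2 sqr_ge0.
apply/rowP => i; rewrite mxE; apply/eqP.
by have := u0 i (mem_index_enum i); rewrite mulf_eq0 orbb.
Qed.

Lemma enorm_ge0 u : 0 <= enorm u.
Proof. exact: sqrtr_ge0. Qed.

Lemma sqr_enorm u : enorm u ^+ 2 = dot u u.
Proof.
rewrite sqr_sqrtr; first by apply: eq_bigr => i _; rewrite expr2.
by apply: sumr_ge0 => i _; rewrite sqr_ge0.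
Qed.

Lemma enormN u : enorm (- u) = enorm u.
Proof. by congr Num.sqrt; apply: eq_bigr => i _; rewrite mxE sqrrN. Qed.

Lemma cauchy_schwarz u v : dot u v <= enorm u * enorm v.
Proof.
apply: (le_trans (ler_norm _)).
rewrite -ler_sqr ?nnegrE ?normr_ge0 ?mulr_ge0 ?enorm_ge0//.
rewrite real_normK ?num_real// exprMn !sqr_enorm.
have [v0|v0] := eqVneq (dot v v) 0.
  rewrite (dot_eq0 _ v0) -(scale0r 0) !dotZr !mul0r mulr0 expr0n//.
have v_gt0 : 0 < dot v v by rewrite lt_neqAle eq_sym v0 dot_ge0.
(* The squared distance from [u] to the line of [v], cleared of denominators. *)
have := dot_ge0 (dot v v *: u - dot u v *: v).
rewrite !dotE (dotC v u).
rewrite [X in 0 <= X](_ : _ = dot v v * (dot u u * dot v v - dot u v ^+ 2)).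
  by rewrite pmulr_rge0// subr_ge0.
ring.
Qed.

Lemma enorm_triangle u v : enorm (u + v) <= enorm u + enorm v.
Proof.
rewrite -ler_sqr ?nnegrE ?addr_ge0 ?enorm_ge0//.
have := cauchy_schwarz u v.
rewrite sqrrD !sqr_enorm !dotE (dotC v u); lra.
Qed.

End Euclidean.

Section Prox.
Context {R : realType} {N : nat}.
Implicit Types (phi : 'rV[R]_N -> \bar R) (u v y z : 'rV[R]_N).

Lemma prox_fin_num phi y u :
  proper_efun phi -> prox phi y u -> (phi u \is a fin_num)%E.
Proof.
move=> [phiNy [x phix]] /(_ x); rewrite fin_numE phiNy /=.
have := phiNy x; case: (phi x) phix => [a|//|//] _ _.
by case: (phi u).
Qed.

(** The quadratic defect of convexity along a segment: the square terms
    combine through [|tv + (1-t)u|^2 = t|v|^2 + (1-t)|u|^2 - t(1-t)|v-u|^2]. *)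
Lemma weakly_convex_segment (rho : R) phi u v (a b t : R) :
    (forall x, phi x != -oo%E) -> weakly_convex rho phi ->
    phi u = a%:E -> phi v = b%:E -> 0 <= t <= 1 ->
  exists2 c, phi (t *: v + (1 - t) *: u) = c%:E &
    c <= t * b + (1 - t) * a + rho / 2 * (t * (1 - t)) * enorm (v - u) ^+ 2.
Proof.
move=> phiNy phi_cvx phiu phiv t01.
have := phi_cvx v u t t01; rewrite phiu phiv.
have := phiNy (t *: v + (1 - t) *: u).
case: (phi _) => [c|//|//] _.
rewrite -!EFinD lee_fin => c_le; exists c => //.
move: c_le; rewrite !sqr_enorm !dotE (dotC v u); lra.
Qed.

(** Minimality of [u], tested at [t v + (1 - t) u] and divided by [t], gives
    this bound with an extra factor [1 - t] on the last term of the left-hand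
    side; the factor disappears as [t] tends to [0]. *)
Lemma prox_growth (L : R) phi y u v (a b : R) :
    (forall x, phi x != -oo%E) -> weakly_convex (1 - 1 / L) phi ->
    prox phi y u -> phi u = a%:E -> phi v = b%:E ->
  a + 1 / 2 * enorm (u - y) ^+ 2 + 1 / (2 * L) * enorm (v - u) ^+ 2
    <= b + 1 / 2 * enorm (v - y) ^+ 2.
Proof.
move=> phiNy phi_cvx uP phiu phiv; set D := enorm (v - u) ^+ 2.
pose d := b - a + 1 / 2 * (enorm (v - y) ^+ 2 - enorm (u - y) ^+ 2).
have slope t : 0 < t -> t <= 1 -> (1 - t) * (1 / (2 * L) * D) <= d.
  move=> t_gt0 t_le1.
  have t01 : 0 <= t <= 1 by rewrite ltW.
  have [c phic c_le] := weakly_convex_segment _ _ _ _ _ _ _ phiNy phi_cvx phiu phiv t01.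
  have := uP (t *: v + (1 - t) *: u).
  rewrite phic phiu -!EFinD lee_fin => u_min.
  rewrite -(ler_pM2l t_gt0).
  move: c_le u_min; rewrite /d /D.
  rewrite [1 / (2 * L)](_ : _ = 1 / L / 2); last by rewrite !mul1r invfM mulrC.
  rewrite !sqr_enorm !dotE (dotC v u) (dotC y u) (dotC y v); lra.
suff : 1 / (2 * L) * D <= d by rewrite /d; lra.
set e := 1 / (2 * L) * D in slope *.
rewrite leNgt; apply/negP => d_lt_e.
have d_ge0 : 0 <= d by have := slope 1 ltr01 (lexx _); rewrite subrr mul0r.
have e_gt0 : 0 < e by exact: le_lt_trans d_lt_e.
(* For this [t], [(1 - t) * e] is the midpoint of [d] and [e], so it exceeds
   [d], against [slope]. *)
have := slope ((e - d) / (2 * e)).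
have -> : (1 - (e - d) / (2 * e)) * e = (e + d) / 2.
  by field; rewrite gt_eqF.
have e2_gt0 : 0 < 2 * e by lra.
have t_gt0 : 0 < (e - d) / (2 * e) by rewrite divr_gt0// subr_gt0.
have t_le1 : (e - d) / (2 * e) <= 1 by rewrite ler_pdivrMr//; lra.
move=> /(_ t_gt0 t_le1); lra.
Qed.

(** In the sum of the growth inequalities at [u] and at [v], the values of
    [phi] cancel and the squared distances collapse to an inner product. *)
Lemma prox_cocoercive (L : R) phi y z u v :
    proper_efun phi -> weakly_convex (1 - 1 / L) phi ->
    prox phi y u -> prox phi z v ->
  1 / L * enorm (u - v) ^+ 2 <= dot (u - v) (y - z).
Proof.
move=> phi_proper phi_cvx uP vP.
have /fineK/esym phiu := prox_fin_num _ _ _ phi_proper uP.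
have /fineK/esym phiv := prox_fin_num _ _ _ phi_proper vP.
have := prox_growth _ _ _ _ _ _ _ phi_proper.1 phi_cvx uP phiu phiv.
have := prox_growth _ _ _ _ _ _ _ phi_proper.1 phi_cvx vP phiv phiu.
rewrite -(enormN (v - u)) opprB.
rewrite [1 / (2 * L)](_ : _ = 1 / L / 2); last by rewrite !mul1r invfM mulrC.
rewrite !sqr_enorm !dotE ?(dotC v u) ?(dotC y u) ?(dotC y v) ?(dotC z u) ?(dotC z v).
lra.
Qed.

Lemma prox_lipschitz (L : R) phi y z u v :
    0 < L -> proper_efun phi -> weakly_convex (1 - 1 / L) phi ->
    prox phi y u -> prox phi z v ->
  enorm (u - v) <= L * enorm (y - z).
Proof.
move=> L_gt0 phi_proper phi_cvx uP vP.
have := prox_cocoercive _ _ _ _ _ _ phi_proper phi_cvx uP vP.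
rewrite mul1r ler_pdivrMl// => coco.
rewrite -ler_sqr ?nnegrE ?mulr_ge0 ?enorm_ge0 ?(ltW L_gt0)//.
(* Young's inequality [2L <p, q> <= |p|^2 + L^2 |q|^2] in place of
   Cauchy-Schwarz avoids dividing by [enorm (u - v)]. *)
have := dot_ge0 (u - v - L *: (y - z)).
move: coco; rewrite exprMn !sqr_enorm.
move: (u - v) (y - z) => p q.
rewrite !dotE (dotC q p); lra.
Qed.

End Prox.

Theorem proposition6 (R : realType) (N : nat) (L : R)
    (phi : 'rV[R]_N -> \bar R) (eps : R) (g : 'rV[R]_N -> 'rV[R]_N)
    (L_gt0 : 0 < L)
    (phi_proper : proper_efun phi)
    (phi_lsc : lower_semicontinuous phi)
    (phi_wconvex : weakly_convex (1 - 1 / L) phi)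
    (phi_bound : (1 < prox_bound phi)%E)
    (eps_gt0 : 0 < eps)
    (g_approx : type_b_approx eps phi g) :
  forall x y : 'rV[R]_N,
    enorm (g x - g y) <= L * (enorm (x - y) + 2 * eps).
Proof.
move=> x y.
have [r [r_le gx]] := g_approx x; have [s [s_le gy]] := g_approx y.
have gxP : prox phi (x + r) (g x) by rewrite gx.
have gyP : prox phi (y + s) (g y) by rewrite gy.
apply: (le_trans (prox_lipschitz _ _ _ _ _ _ L_gt0 phi_proper phi_wconvex gxP gyP)).
rewrite ler_pM2l// opprD addrACA.
have := enorm_triangle (x - y) (r - s); have := enorm_triangle r (- s).
rewrite enormN; lra.
Qed.
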